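(* Let $G$ be a finite group having period $2$. Then $G$ is cyclic.
   Context: A finite group $G$ has period $2$ if there exists an exact sequence of $\mathbb{Z}[G]$-modules $$0\to \mathbb{Z}\to P_1\to P_0\to \mathbb{Z}\to 0$$ with $P_0,P_1$ finitely generated projective, where $\mathbb{Z}$ carries the trivial $G$-action in both places. *)

(* Defs.v *)
(* MathComp world. *)
From HB Require Import structures.
From mathcomp Require Import all_boot all_order all_algebra all_fingroup.
From mathcomp Require Import all_solvable.

Set Implicit Arguments.
Unset Strict Implicit.
Unset Printing Implicit Defensive.

Import GRing.Theory.
Local Open Scope ring_scope.

(* The integral group ring Z[G]: the element \sum_g (a g) g is encoded by its
   coefficient function a, multiplied by convolution.  It is an alias of
   {ffun gT -> int}, whose own ring structure is the pointwise one. *)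
Definition int_gring (gT : finGroupType) : Type := {ffun gT -> int}.

HB.instance Definition _ (gT : finGroupType) :=
  GRing.Zmodule.copy (int_gring gT) {ffun gT -> int}.

Definition int_gring_one (gT : finGroupType) : int_gring gT :=
  [ffun g : gT => (g == 1%g)%:R].

Definition int_gring_mul (gT : finGroupType) (a b : int_gring gT) :
    int_gring gT :=
  [ffun g : gT => \sum_(x : gT) a x * b (x^-1 * g)%g].

Lemma int_gring_mulA (gT : finGroupType) : associative (@int_gring_mul gT).
Proof.
move=> a b c; apply/ffunP=> g; rewrite !ffunE.
under eq_bigr => x _ do rewrite ffunE mulr_sumr.
under [RHS]eq_bigr => y _ do rewrite ffunE mulr_suml.
rewrite [RHS]exchange_big /=; apply: eq_bigr => x _.
rewrite (reindex_inj (mulgI x^-1%g)) /=; apply: eq_bigr => y _.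
by rewrite mulrA invMg invgK -mulgA mulKVg.
Qed.

Lemma int_gring_mul1 (gT : finGroupType) :
  left_id (int_gring_one gT) (@int_gring_mul gT).
Proof.
move=> a; apply/ffunP=> g; rewrite !ffunE (bigD1 1%g) //= big1 => [|x /negPf nx].
  by rewrite ffunE eqxx mul1r invg1 mul1g addr0.
by rewrite ffunE nx mul0r.
Qed.

Lemma int_gring_mulr1 (gT : finGroupType) :
  right_id (int_gring_one gT) (@int_gring_mul gT).
Proof.
move=> a; apply/ffunP=> g; rewrite !ffunE (bigD1 g) //= big1 => [|x nx].
  by rewrite ffunE mulVg eqxx mulr1 addr0.
by rewrite ffunE -eq_mulVg1 (negPf nx) mulr0.
Qed.

Lemma int_gring_mulDl (gT : finGroupType) :
  left_distributive (@int_gring_mul gT) +%R.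
Proof.
move=> a b c; apply/ffunP=> g; rewrite !ffunE -big_split /=.
by apply: eq_bigr => x _; rewrite ffunE mulrDl.
Qed.

Lemma int_gring_mulDr (gT : finGroupType) :
  right_distributive (@int_gring_mul gT) +%R.
Proof.
move=> a b c; apply/ffunP=> g; rewrite !ffunE -big_split /=.
by apply: eq_bigr => x _; rewrite ffunE mulrDr.
Qed.

Lemma int_gring_one_neq0 (gT : finGroupType) : int_gring_one gT != 0.
Proof. by apply/eqP => /ffunP/(_ 1%g); rewrite !ffunE eqxx. Qed.

HB.instance Definition _ (gT : finGroupType) :=
  GRing.Zmodule_isNzRing.Build (int_gring gT)
    (@int_gring_mulA gT) (@int_gring_mul1 gT) (@int_gring_mulr1 gT)
    (@int_gring_mulDl gT) (@int_gring_mulDr gT) (@int_gring_one_neq0 gT).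

Definition int_gring_aug (gT : finGroupType) (a : int_gring gT) : int :=
  \sum_(g : gT) a g.

(* The trivial Z[G]-module Z: every g in G acts as the identity, so that
   \sum_g (a g) g acts as multiplication by its augmentation \sum_g (a g). *)
Definition triv_int (gT : finGroupType) : Type := int.

HB.instance Definition _ (gT : finGroupType) :=
  GRing.Zmodule.copy (triv_int gT) int.

Definition triv_int_scale (gT : finGroupType) (a : int_gring gT)
    (n : triv_int gT) : triv_int gT :=
  int_gring_aug a * (n : int).

Lemma triv_int_scaleA (gT : finGroupType) (a b : int_gring gT)
    (n : triv_int gT) :
  triv_int_scale a (triv_int_scale b n) = triv_int_scale (a * b) n.
Proof.
rewrite /triv_int_scale mulrA; congr (_ * _); rewrite /int_gring_aug.
rewrite mulr_suml; under [RHS]eq_bigr => g _ do rewrite ffunE.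
rewrite [RHS]exchange_big /=; apply: eq_bigr => x _.
rewrite -mulr_sumr; congr (_ * _).
by rewrite (reindex_inj (mulgI x^-1%g)).
Qed.

Lemma triv_int_scale1 (gT : finGroupType) :
  left_id (1 : int_gring gT) (@triv_int_scale gT).
Proof.
move=> n; rewrite /triv_int_scale /int_gring_aug (bigD1 1%g) //= big1.
  by rewrite ffunE eqxx addr0 mul1r.
by move=> g /negPf ng; rewrite ffunE ng.
Qed.

Lemma triv_int_scaleDr (gT : finGroupType) :
  right_distributive (@triv_int_scale gT) +%R.
Proof. by move=> a m n; rewrite /triv_int_scale mulrDr. Qed.

Lemma triv_int_scaleDl (gT : finGroupType) (n : triv_int gT) :
  {morph (@triv_int_scale gT)^~ n : a b / a + b}.
Proof.
move=> a b; rewrite /triv_int_scale -mulrDl /int_gring_aug -big_split /=.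
by congr (_ * _); apply: eq_bigr => g _; rewrite ffunE.
Qed.

HB.instance Definition _ (gT : finGroupType) :=
  GRing.Zmodule_isLmodule.Build (int_gring gT) (triv_int gT)
    (@triv_int_scaleA gT) (@triv_int_scale1 gT) (@triv_int_scaleDr gT)
    (@triv_int_scaleDl gT).

Definition finitely_generated (R : nzRingType) (P : lmodType R) : Prop :=
  exists (n : nat) (v : 'I_n -> P),
    forall x : P, exists c : 'I_n -> R, x = \sum_(i < n) c i *: v i.

Definition projective (R : nzRingType) (P : lmodType R) : Prop :=
  forall (M N : lmodType R) (p : {linear M -> N}) (f : {linear P -> N}),
    (forall y : N, exists x : M, p x = y) ->
    exists h : {linear P -> M}, forall x : P, p (h x) = f x.

Definition exact_at (R : nzRingType) (L M N : lmodType R)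
    (f : {linear L -> M}) (g : {linear M -> N}) : Prop :=
  forall y : M, g y = 0 <-> exists x : L, f x = y.

Definition has_period2 (gT : finGroupType) : Prop :=
  exists (P1 P0 : lmodType (int_gring gT))
         (i : {linear triv_int gT -> P1})
         (d : {linear P1 -> P0})
         (e : {linear P0 -> triv_int gT}),
    [/\ finitely_generated P1 /\ projective P1,
        finitely_generated P0 /\ projective P0,
        injective i,
        exact_at i d /\ exact_at d e
      & forall n : triv_int gT, exists x : P0, e x = n].

(* Main.v *)
From HB Require Import structures.
Require Import Defs.
From mathcomp Require Import all_boot all_order all_algebra all_fingroup.
From mathcomp Require Import all_solvable.

Set Implicit Arguments.
Unset Strict Implicit.
Unset Printing Implicit Defensive.

Import Order.TTheory GRing.Theory Num.Theory.
Local Open Scope ring_scope.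

(** Dimension shifting along the resolution identifies H^2(G, Z) with the Tate
    group H^0(G, Z) = Z / #|G|, while H^2(G, Z) = Hom(G, Q/Z).  So G has a
    character whose order is #|G|, and the argument below shows directly that
    this character G -> Z / #|G| is injective; hence G is cyclic.

    Construction of the character ([connecting_cocycle]).  Lift 1 in Z to some
    x in P0 and lift g x - x along d to some y_g in P1.  The defect of y from
    being a 1-cocycle is a 2-cocycle with values in Z, which represents the
    class of the resolution in H^2(G, Z).  With Y the sum of all the y_h,
    #|G| y_g + g Y - Y is the image of an integer s_g, and s is additive modulo
    #|G|; it is the character attached to that 2-cocycle.  Moving y_g by the
    quotient of s_g by #|G| gives another lift z_g which satisfies the cocycle
    rule z_(g k) = z_g + g z_k whenever #|G| divides s_k.

    Injectivity.  On the kernel K of the character, z is a 1-cocycle with values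
    in the projective P1, hence the coboundary of some w in P1 ([cocycle_bound]).
    Then x - d w is fixed by K and still maps to 1 in Z.  But a fixed point of K
    in the projective P0 is a norm from K, so that its image in Z is a multiple
    of #|K| ([fixed_point_image]); hence K = 1.

    Projectivity enters only through [projective_trace]: the identity of a
    finitely generated projective module is the trace over G of an additive
    endomorphism. *)

Section GroupElements.

Variable gT : finGroupType.
Implicit Types g h : gT.

Definition gelt g : int_gring gT := [ffun h => (h == g)%:R].

Lemma gelt1 : gelt 1%g = 1.
Proof. by []. Qed.

Lemma mul_geltE g (a : int_gring gT) h : (gelt g * a) h = a (g^-1 * h)%g.
Proof.
rewrite ffunE (bigD1 g) //= big1 => [|x /negPf nx].
  by rewrite ffunE eqxx mul1r addr0.
by rewrite ffunE nx mul0r.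
Qed.

Lemma geltM g h : gelt (g * h)%g = gelt g * gelt h.
Proof.
apply/ffunP=> x; rewrite mul_geltE !ffunE; congr (_ %:R).
by rewrite -(inj_eq (mulgI g) (g^-1 * x)%g) mulKVg.
Qed.

Lemma gelt_decomp (a : int_gring gT) : a = \sum_g gelt g *~ a g.
Proof.
apply/ffunP=> h; rewrite sum_ffunE (bigD1 h) //= big1 => [|g ng].
  by rewrite addr0 ffunMzE ffunE eqxx -mulrzr mul1r intz.
by rewrite ffunMzE ffunE eq_sym (negPf ng) mul0rz.
Qed.

Lemma gelt_triv g (n : triv_int gT) : gelt g *: n = n.
Proof.
rewrite /GRing.scale /= /triv_int_scale /int_gring_aug (bigD1 g) //= big1.
  by rewrite ffunE eqxx addr0 mul1r.
by move=> h /negPf nh; rewrite ffunE nh.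
Qed.

End GroupElements.

(** On Z[G] itself the endomorphism a |-> a(1) has trace the identity; on a
    quotient of Z[G]^n by a split surjection, with section h and generators v,
    the same coefficient is read off along h and pushed back along v. *)
Lemma projective_trace (gT : finGroupType) (P : lmodType (int_gring gT)) :
    finitely_generated P -> projective P ->
  exists theta : P -> P, {morph theta : x y / x + y} /\
    forall x, x = \sum_g gelt g *: theta (gelt g^-1 *: x).
Proof.
case=> n [v genv] projP.
pose p (c : 'rV[int_gring gT]_n) : P := \sum_(j < n) c 0 j *: v j.
have linp : linear p.
  move=> a c c'; rewrite /p scaler_sumr -big_split /=; apply: eq_bigr => j _.
  by rewrite !mxE scalerDl scalerA.
pose pL : {linear _ -> P} := HB.pack p (GRing.isLinear.Build _ _ _ _ p linp).
have surj_p y : exists c, pL c = y.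
  have [c ->] := genv y; exists (\row_j c j).
  by apply: eq_bigr => j _; rewrite mxE.
have [h ph] := projP _ _ pL idfun surj_p.
exists (fun x => \sum_(j < n) v j *~ (h x 0 j 1%g)); split=> [x y|x].
  by rewrite -big_split; apply: eq_bigr => j _; rewrite linearD mxE ffunE mulrzDr.
under eq_bigr => g _ do rewrite scaler_sumr.
rewrite exchange_big /= -[LHS]ph; apply: eq_bigr => j _.
rewrite [in LHS](gelt_decomp (h x 0 j)) scaler_suml; apply: eq_bigr => g _.
by rewrite linearZ mxE mul_geltE invgK mulg1 -scalerMzr scalerMzl.
Qed.

Section ProjectiveModule.

Variables (gT : finGroupType) (P : lmodType (int_gring gT)).
Hypotheses (fgP : finitely_generated P) (projP : projective P).

(** The summands of the trace formula for a K-fixed x have images in Z which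
    are constant on the right cosets of K. *)
Lemma fixed_point_image (K : {group gT}) (f : {linear P -> triv_int gT}) x :
    {in K, forall k, gelt k *: x = x} ->
  exists m : int, f x = m *+ #|K|.
Proof.
move=> fixx; have [theta [_ trace]] := projective_trace fgP projP.
pose t (g : gT) : int := f (theta (gelt g^-1 *: x)).
have tK : forall k g, k \in K -> t (k * g)%g = t g.
  by move=> k g Kk; rewrite /t invMg geltM -scalerA fixx ?groupV.
exists (\sum_(C in rcosets K [set: gT]) t (repr C)).
rewrite {1}[x]trace linear_sum.
rewrite (partition_big (fun g => (K :* g)%g) (mem (rcosets K [set: gT]))) /=;
  last by move=> g _; rewrite mem_rcosets mulSGid ?subsetT ?inE.
rewrite -sumrMnl; apply: eq_bigr => C CK.
have [g _ defC] := rcosetsP CK.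
have <- : #|C| = #|K| by rewrite defC card_rcoset.
rewrite -sumr_const; apply: eq_big => [h | h /eqP defhC].
  by rewrite defC; apply/eqP/idP=> /rcoset_eqP.
rewrite linearZ /= gelt_triv -/(t h).
have: repr C \in (K :* h)%g by rewrite defhC defC mem_repr_rcoset.
by case/rcosetP=> k Kk ->; rewrite tK.
Qed.

(** H^1 of a projective module vanishes.  The element w is the usual
    contracting sum; the cocycle rule is required only for the given k on the
    right, so one w serves for every k at which z behaves as a cocycle. *)
Lemma cocycle_bound (z : gT -> P) :
  exists w : P, forall k,
    (forall g, z (g * k)%g = z g + gelt g *: z k) -> z k = gelt k *: w - w.
Proof.
have [theta [thetaD trace]] := projective_trace fgP projP.
pose w := \sum_g gelt g *: theta (z g^-1%g).
exists w => k zk; apply/eqP; rewrite eq_sym subr_eq addrC eq_sym; apply/eqP.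
rewrite {1}[z k]trace -big_split [RHS]scaler_sumr /=.
rewrite [RHS](reindex_inj (mulgI k^-1%g)); apply: eq_bigr => g _.
by rewrite scalerA -geltM mulKVg invMg invgK zk thetaD scalerDr.
Qed.

End ProjectiveModule.

(** The numbers r_g, taken in [0, #|G|), represent the values of the character;
    the relation z_(g k) = z_g + g z_k for k in its kernel holds because the
    defect is an integer m with #|G| m = r_g - r_(g k), a difference of two
    residues in that range. *)
Lemma connecting_cocycle (gT : finGroupType) (P1 P0 : lmodType (int_gring gT))
    (i : {linear triv_int gT -> P1}) (d : {linear P1 -> P0})
    (e : {linear P0 -> triv_int gT}) (x : P0) :
    injective i -> exact_at i d -> exact_at d e ->
  exists (z : gT -> P1) (r : gT -> nat),
    [/\ forall g, d (z g) = gelt g *: x - x,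
        forall g h, r (g * h)%g = r g + r h %[mod #|gT|]
      & forall k g, (#|gT| %| r k)%N -> z (g * k)%g = z g + gelt g *: z k].
Proof.
move=> inji exd exe; pose n := #|gT|.
have n_gt0 : (0 < n)%N by apply/card_gt0P; exists 1%g.
have nZ : n%:Z != 0 by rewrite eqz_nat -lt0n.
have /fin_all_exists[y dy] g : exists v, d v = gelt g *: x - x.
  apply: (exe _).1.
  by rewrite linearB linearZ /= gelt_triv subrr.
pose Y := \sum_h y h.
have dY g : d (gelt g *: Y - Y) = (x - gelt g *: x) *+ n.
  have dsum : d Y = \sum_h gelt h *: x - x *+ n.
    rewrite linear_sum; under eq_bigr => h _ do rewrite dy.
    by rewrite sumrB sumr_const.
  rewrite linearB linearZ /= dsum scalerBr -scalerMnr mulrnBl.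
  have -> : gelt g *: (\sum_h gelt h *: x) = \sum_h gelt h *: x.
    rewrite scaler_sumr [RHS](reindex_inj (mulgI g)) /=.
    by apply: eq_bigr => h _; rewrite scalerA -geltM.
  by rewrite opprB addrC addrA subrK.
have /fin_all_exists[s is_] g :
    exists m, i m = y g *+ n + (gelt g *: Y - Y).
  apply: (exd _).1.
  by rewrite linearD linearMn dY dy -mulrnDl addrA subrK subrr mul0rn.
pose q g : triv_int gT := (s g %/ n%:Z)%Z.
pose r g := `|(s g %% n%:Z)%Z|%N.
have rE g : (r g)%:Z = (s g %% n%:Z)%Z by rewrite /r gez0_abs ?modz_ge0.
have sE g : s g = (q g *+ n + (r g)%:Z : int).
  by rewrite rE [LHS](divz_eq (s g) n) -mulr_natr natz.
have r_lt g : (r g < n)%N by rewrite -ltz_nat rE ltz_pmod.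
pose z g := y g - i (q g).
have zn g : z g *+ n = Y - gelt g *: Y + i (r g)%:Z.
  rewrite mulrnBl -linearMn.
  have -> : y g *+ n = i (s g) + (Y - gelt g *: Y).
    by rewrite is_ -addrA -[Y - _]opprB subrr addr0.
  by rewrite sE linearD -addrA addrC addrA subrK.
have dz g : d (z g) = gelt g *: x - x.
  by rewrite linearB dy (_ : d (i _) = 0) ?subr0 //; apply: (exd _).2; exists (q g).
(* m is the value at (g, h) of the 2-cocycle defined by the lift z; comparing
   #|G| times both sides cancels every multiple of Y. *)
have zM g h : exists m : int,
    z g + gelt g *: z h = z (g * h)%g + i m /\
    (r g + r h)%:Z = (r (g * h)%g)%:Z + m *+ n.
  have [|m im] := (exd (z g + gelt g *: z h - z (g * h)%g)).1.
    rewrite linearB linearD linearZ /= !dz scalerBr scalerA -geltM.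
    by rewrite opprB [gelt g *: x - x + _]addrC !addrA !subrK subrr.
  exists m; rewrite im [RHS]addrC subrK; split=> //; apply: inji.
  rewrite PoszD linearD /= [RHS]linearD linearMn /= im.
  rewrite mulrnBl mulrnDl scalerMnr !zn.
  rewrite scalerDr scalerBr scalerA -geltM -linearZ /= gelt_triv.
  rewrite addrACA [Y - _ + (_ - _)]addrA subrK opprD addrACA subrr add0r.
  by rewrite [RHS]addrC subrK.
have rM g h : r (g * h)%g = r g + r h %[mod n].
  have [m [_ rm]] := zM g h; apply/eqP.
  by rewrite -eqz_nat -!modz_nat rm -mulr_natr natz addrC modzMDl.
exists z, r; split=> // k g; rewrite /dvdn modn_small // => /eqP rk0.
have [m [-> rm]] := zM g k.
have rgk : r (g * k)%g = r g.
  by have:= rM g k; rewrite rk0 addn0 !modn_small.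
suff -> : m = 0 by rewrite linear0 addr0.
move/eqP: rm; rewrite rk0 addn0 rgk -[X in X == _]addr0 (inj_eq (addrI _)).
by rewrite eq_sym mulrn_eq0 -[n == _]negbK -lt0n n_gt0 => /eqP.
Qed.

Theorem theorem1p4p11 (gT : finGroupType) :
  has_period2 gT -> cyclic [set: gT].
Proof.
case=> P1 [P0 [i [d [e [[fg1 pr1] [fg0 pr0] inji [exd exe] surje]]]]].
have [x ex1] := surje (1 : int).
have [z [r [dz rM zK]]] := connecting_cocycle x inji exd exe.
have n_gt0 : (0 < #|gT|)%N by apply/card_gt0P; exists 1%g.
pose f (g : gT) : 'I_#|gT|.-1.+1 := inZp (r g).
have fM : {in [set: gT] &, {morph f : g h / (g * h)%g}}.
  by move=> g h _ _; apply: val_inj; rewrite /= prednK // modnDm.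
pose fm := Morphism fM.
have cycI : cyclic [set: 'I_#|gT|.-1.+1] by rewrite Zp_cycle cycle_cyclic.
suff /card1_trivg kerf : #|('ker fm)%G| = 1%N.
  rewrite -(injm_cyclic (f := fm)) //; first exact: cyclicS (subsetT _) cycI.
  by rewrite kerf.
have [w zw] := cocycle_bound fg1 pr1 z.
have fixw : {in ('ker fm)%G, forall k, gelt k *: (x - d w) = x - d w}.
  move=> k /kerP; rewrite inE => /(_ isT)/(congr1 val)/=; rewrite prednK //.
  move=> rk0; have zk : z k = gelt k *: w - w.
    by apply: zw => g; apply: zK; apply/eqP.
  have := dz k; rewrite zk linearB linearZ /= => dk.
  apply/eqP; rewrite scalerBr subr_eq addrAC -addrA dk.
  by rewrite [eqbRHS]addrC subrK.
have [m] := fixed_point_image fg0 pr0 e fixw.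
have -> : e (x - d w) = (1 : int).
  by rewrite linearB /= ex1 (_ : e (d w) = 0) ?subr0 //; apply: (exe _).2; exists w.
rewrite -mulr_natr natz => /(congr1 absz)/esym/eqP; rewrite abszM muln_eq1.
by case/andP=> _ /eqP.
Qed.
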